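(* Let $G \in \mathbb{CR}$. The outcome class of $G$ is one of $\mathcal{L}$, $\mathcal{D}$, or $\mathcal{R}$.
   Context: Short cr-games (Cheating Robot games). The set $\mathbb{CR}$ of short cr-games (positions) is defined recursively. A position $G$ consists of a finite list $G(L)$ of $m\ge 0$ Left moves $G(i,\cdot)$, a finite list $G(R)$ of $n\ge 0$ Right moves $G(\cdot,j)$, and, for each $i$ a Left option $G^{i,\cdot}$, for each $j$ a Right option $G^{\cdot,j}$, and for each pair $(i,j)$ a same-round option $G^{i,j}$, all options being previously constructed positions. One writes $G=\{G^L\mid S(G)\mid G^R\}$, where $G^L$, $G^R$ are the lists of Left and Right options and $S(G)$ is the $m\times n$ matrix with entries $G^{i,j}$ ($S(G)=\emptyset$ if $m=0$ or $n=0$). The base case is $0=\{\,\cdot\mid\cdot\mid\cdot\,\}$ (no moves); a dot denotes an empty list. Play and outcomes. Play proceeds in rounds: in a round from $G$, Left chooses a move $G(i,\cdot)$; then Right, knowing Left's choice, chooses a move $G(\cdot,j)$; the new position is $G^{i,j}$. Play ends when at least one player has no move at the beginning of a round. If $S(G)=\emptyset$: Left wins ($o(G)=\mathcal L$) if $G(L)\ne\emptyset$; Right wins ($o(G)=\mathcal R$) if $G(R)\neq\emptyset$; otherwise $G$ is a draw ($o(G)=\mathcal D$). If $S(G)\ne\emptyset$: $o(G)=\mathcal L$ if Left can force a win, $o(G)=\mathcal R$ if Right can force a win, and otherwise $o(G)=\mathcal D$. *)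

(* Defs.v *)
From mathcomp Require Import all_boot.

Set Implicit Arguments.
Unset Strict Implicit.
Unset Printing Implicit Defensive.

(* Moves are list indices: the Left moves of a position are 'I_m, its Right
   moves 'I_n.  Only the same-round options [GS] are ever reached in play. *)
Inductive cr : Type :=
  CR (m n : nat) (GL : 'I_m -> cr) (GR : 'I_n -> cr) (GS : 'I_m -> 'I_n -> cr).

Definition nL (G : cr) : nat := let: CR m _ _ _ _ := G in m.

Definition nR (G : cr) : nat := let: CR _ n _ _ _ := G in n.

Definition left_option (G : cr) : 'I_(nL G) -> cr :=
  let: CR _ _ GL _ _ := G in GL.

Definition right_option (G : cr) : 'I_(nR G) -> cr :=
  let: CR _ _ _ GR _ := G in GR.

Definition round_option (G : cr) : 'I_(nL G) -> 'I_(nR G) -> cr :=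
  let: CR _ _ _ _ GS := G in GS.

Definition S_empty (G : cr) : bool := (nL G == 0) || (nR G == 0).

Definition left_strategy : Type := forall G : cr, ~~ S_empty G -> 'I_(nL G).

(* Right sees Left's choice of the current round before choosing. *)
Definition right_strategy : Type :=
  forall G : cr, ~~ S_empty G -> 'I_(nL G) -> 'I_(nR G).

(* [left_play s G H]: some play from [G] in which Left follows [s] and Right
   moves arbitrarily ends at [H]. *)
Inductive left_play (s : left_strategy) : cr -> cr -> Prop :=
| left_play_end (G : cr) : S_empty G -> left_play s G G
| left_play_round (G H : cr) (hG : ~~ S_empty G) (j : 'I_(nR G)) :
    left_play s (round_option (s G hG) j) H -> left_play s G H.

Inductive right_play (t : right_strategy) : cr -> cr -> Prop :=
| right_play_end (G : cr) : S_empty G -> right_play t G G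
| right_play_round (G H : cr) (hG : ~~ S_empty G) (i : 'I_(nL G)) :
    right_play t (round_option i (t G hG i)) H -> right_play t G H.

Definition left_can_force_win (G : cr) : Prop :=
  exists s : left_strategy, forall H : cr, left_play s G H -> 0 < nL H.

Definition right_can_force_win (G : cr) : Prop :=
  exists t : right_strategy, forall H : cr, right_play t G H -> 0 < nR H.

Definition left_wins (G : cr) : Prop :=
  if S_empty G then is_true (0 < nL G) else left_can_force_win G.

Definition right_wins (G : cr) : Prop :=
  if S_empty G then is_true (0 < nR G) else right_can_force_win G.

Inductive outcome : Type := Lwin | Draw | Rwin.

(* A relation rather than a function, so that the disjointness of left
   and right wins is not built into the definition. *)
Definition has_outcome (G : cr) (o : outcome) : Prop :=
  match o with
  | Lwin => left_wins G
  | Rwin => right_wins G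
  | Draw => ~ left_wins G /\ ~ right_wins G
  end.

(* Main.v *)
Require Import Defs.
From mathcomp Require Import all_boot.
From Stdlib Require Import Classical.

(** Since a draw means by definition that neither player wins, an outcome
    exists by excluded middle; the content of the theorem is that the two
    players cannot both win.  If each had a winning strategy, playing one
    against the other would give a single play consistent with both
    ([common_play]), which terminates because positions are well founded.  Its
    final position would offer a move to both players, whereas a play ends only
    when one of them has none. *)

Lemma S_empty_not_both (G : cr) : S_empty G -> 0 < nL G -> 0 < nR G -> False.
Proof. by rewrite /S_empty !lt0n => /orP[] ->. Qed.

(** In each round Right's strategy answers the move given by Left's strategy,
    so every round is determined and leads to a structurally smaller position;
    the play is built by recursion on the position. *)
Lemma common_play (s : left_strategy) (t : right_strategy) (G : cr) :
  exists H, [/\ S_empty H, left_play s G H & right_play t G H].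
Proof.
elim: G => m n GL _ GR _ GS IH; set G := CR _ _ _.
have [G0 | hG] := boolP (S_empty G).
  by exists G; split=> //; constructor.
have [H [H0 sH tH]] := IH (s G hG) (t G hG (s G hG)).
exists H; split=> //.
- exact: (@left_play_round s G H hG (t G hG (s G hG)) sH).
- exact: (@right_play_round t G H hG (s G hG) tH).
Qed.

Lemma not_both_win (G : cr) : left_wins G -> right_wins G -> False.
Proof.
rewrite /left_wins /right_wins; case: ifP => [|_ [s sW] [t tW]].
  exact: S_empty_not_both.
have [H [H0 sH tH]] := common_play s t G.
exact: S_empty_not_both H0 (sW H sH) (tW H tH).
Qed.

Theorem theorem1 (G : cr) : exists! o : outcome, has_outcome G o.
Proof.
have LR := @not_both_win G.
have [Lw | nL] := classic (left_wins G).
  by exists Lwin; split=> // -[|[]|/(LR Lw)].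
have [Rw | nR] := classic (right_wins G).
  by exists Rwin; split=> // -[/nL|[]|].
by exists Draw; split=> // -[/nL||/nR].
Qed.
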